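(* Let $H$ be a complex Hilbert space and let $T\in B(H)$ be a selfadjoint rank one operator with $\operatorname{tr}T\neq 0$. Then $\mathcal S(T)$ is simple if and only if $\operatorname{tr}T\in\{-1,1\}$.
   Context: $H$ may be finite or infinite dimensional; $B(H)$ is the set of bounded linear operators on $H$. $\mathcal S(T)=\{T^n: n\ge1\}$ is the multiplicative semigroup generated by $T$. An ideal $J$ of a semigroup $\mathcal S\subset B(H)$ is a (two-sided) multiplicative ideal: a subset $J\subset\mathcal S$ with $XA, AX\in J$ for all $A\in J$, $X\in\mathcal S$ (no closure under sums or scalars is required). $\mathcal S$ is simple if its only nonzero ideal (i.e. ideal containing a nonzero operator) is $\mathcal S$ itself. $\operatorname{tr}$ denotes the trace. *)

(* Defs.v *)
From mathcomp Require Import all_boot all_order all_algebra finmap.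
From mathcomp Require Import complex.
From mathcomp Require Import all_classical all_reals all_analysis.
From mathcomp.analysis.showcase Require Import summability.

Set Implicit Arguments.
Unset Strict Implicit.
Unset Printing Implicit Defensive.

Import Order.TTheory GRing.Theory Num.Theory.
Import numFieldNormedType.Exports.

Local Open Scope classical_set_scope.
Local Open Scope ring_scope.
Local Open Scope complex_scope.

(** [dot] is linear in its first argument.  A complete complex normed module
    whose norm comes from [dot] in this way is a complex Hilbert space. *)
Definition norm_from_dot (R : realType) (H : completeNormedModType R[i])
    (dot : {dot H for (@Num.conj R[i])}) : Prop :=
  forall x : H, `|x| ^+ 2 = dot x x.

Definition bounded_operator (R : realType) (H : completeNormedModType R[i])
    (T : {linear H -> H}) : Prop :=
  exists M : R[i], forall x : H, `|T x| <= M * `|x|.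

Definition selfadjoint (R : realType) (H : completeNormedModType R[i])
    (dot : {dot H for (@Num.conj R[i])}) (T : H -> H) : Prop :=
  forall x y : H, dot (T x) y = dot x (T y).

Definition rank_one (R : realType) (H : completeNormedModType R[i])
    (T : H -> H) : Prop :=
  exists2 v : H, v != 0 & range T = [set a *: v | a in [set: R[i]]].

Definition orthonormal_basis (R : realType) (H : completeNormedModType R[i])
    (dot : {dot H for (@Num.conj R[i])}) (E : set H) : Prop :=
  (forall e f : H, E e -> E f -> dot e f = (e == f)%:R) /\
  (forall x : H, (forall e : H, E e -> dot x e = 0) -> x = 0).

(** The net of finite partial sums of <T e, e>, e in E, converges to [c], for
    every orthonormal basis [E] (of any cardinality); [f \_ E] is [f] extended
    by 0 outside [E]. *)
Definition has_trace (R : realType) (H : completeNormedModType R[i])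
    (dot : {dot H for (@Num.conj R[i])}) (T : H -> H) (c : R[i]) : Prop :=
  forall E : set H, orthonormal_basis dot E ->
    partial_sum ((fun e : H => dot (T e) e) \_ E) A @[A --> totally] --> (c : R[i]^o).

(** Junk value 0 when [T] has no trace. *)
Definition trace (R : realType) (H : completeNormedModType R[i])
    (dot : {dot H for (@Num.conj R[i])}) (T : H -> H) : R[i] :=
  xget 0 [set c | has_trace dot T c].

Definition generated_semigroup (X : Type) (T : X -> X) : set (X -> X) :=
  [set iter n T | n in [set n | (1 <= n)%N]].

Definition semigroup_ideal (X : Type) (S J : set (X -> X)) : Prop :=
  J `<=` S /\ (forall A B, J A -> S B -> J (B \o A) /\ J (A \o B)).

Definition simple_semigroup (X : zmodType) (S : set (X -> X)) : Prop :=
  forall J : set (X -> X), semigroup_ideal S J ->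
    (exists2 A, J A & A <> (fun=> 0)) -> J = S.

(* Main.v *)
(** A selfadjoint rank one [T] has the form [x |-> <x, a> b] with [<b, a>]
    real, so that [T^(n+1) = <b, a>^n T].  Its trace is [<b, a>]: the diagonal
    sum of [T] in an orthonormal basis is the inner product with [a] of the
    Fourier expansion of [b].  Since [trace] quantifies over all orthonormal
    bases, its uniqueness also needs the existence of one, by Zorn's lemma.
    If the semigroup is simple, its ideal [{T^n : n >= 2}], nonzero because
    [T^2] is, contains [T], so [T] is periodic.  Conversely, periodicity makes
    every power of [T] a multiple of every other one.  Hence simplicity means
    that the real number [tr T] is a root of unity. *)

Require Import Defs.
From mathcomp Require Import all_boot all_order all_algebra complex finmap.
From mathcomp Require Import all_classical all_reals all_analysis.
From mathcomp.analysis.showcase Require Import summability.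

Set Implicit Arguments.
Unset Strict Implicit.
Unset Printing Implicit Defensive.

Import Order.TTheory GRing.Theory Num.Theory.
Import numFieldNormedType.Exports.

Local Open Scope classical_set_scope.
Local Open Scope ring_scope.

Lemma real_unity_rootP (K : numDomainType) (c : K) : c \is Num.real ->
  (exists2 n, (0 < n)%N & c ^+ n = 1) <-> c = -1 \/ c = 1.
Proof.
move=> cR; split=> [[n n0 cn1]|c1]; last first.
  by exists 2 => //; case: c1 => ->; rewrite ?sqrrN expr1n.
have /eqP : `|c| ^+ n = 1 by rewrite -normrX cn1 normr1.
rewrite pexpr_eq1// => /eqP c1; have /orP[c0|c0] := cR; [right|left]; rewrite -c1.
  by rewrite ger0_norm.
by rewrite ler0_norm// opprK.
Qed.

Lemma sumr_fsetD (I : choiceType) (V : zmodType) (P : pred I) (F : I -> V)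
    (A B : {fset I}) : (A `<=` B)%fset ->
  \sum_(i <- (B `\` A)%fset | P i) F i =
  \sum_(i <- B | P i) F i - \sum_(i <- A | P i) F i.
Proof.
move=> AB; rewrite (big_fsetIDcond _ (mem A) B) /=.
have -> : [fset i in B | i \in A]%fset = A.
  apply/fsetP => i; rewrite !inE andbC.
  by case: (boolP (i \in A)) => //= /(fsubsetP AB) ->.
rewrite addrAC subrr add0r; congr (\sum_(i <- enum_fset _ | P i) F i).
by apply/fsetP => i; rewrite !inE andbC.
Qed.

Lemma partial_sum_patch (I : choiceType) (V : zmodType) (f : I -> V)
    (E : set I) (A : {fset I}) :
  partial_sum (f \_ E) A = \sum_(i <- A | i \in E) f i.
Proof. by rewrite [RHS]big_mkcond [RHS]big_seq_fsetE. Qed.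

Lemma comp_iter (X : Type) (T : X -> X) m n :
  iter m T \o iter n T = iter (m + n) T.
Proof. by apply/funext => x; rewrite /= iterD. Qed.

Lemma semigroup_ideal_iter_gt (X : Type) (T : X -> X) m :
  semigroup_ideal (generated_semigroup T)
    [set iter n T | n in [set n | (m < n)%N]].
Proof.
split=> [_ [n /= mn <-]|_ _ [n /= mn <-] [k _ <-]].
  by exists n => //=; exact: leq_ltn_trans mn.
rewrite !comp_iter; split; [exists (k + n)%N|exists (n + k)%N] => //=.
  by rewrite (leq_trans mn)// leq_addl.
by rewrite (leq_trans mn)// leq_addr.
Qed.

Lemma iter_periodic (X : Type) (T : X -> X) p : iter p.+1 T = T ->
  forall n q, iter (n.+1 + q * p) T = iter n.+1 T.
Proof.
move=> Tp n; elim=> [|q IHq]; first by rewrite addn0.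
have -> : (n.+1 + q.+1 * p = n + q * p + p.+1)%N.
  by rewrite mulSn addnS addSn [(p + _)%N]addnC addnA.
by rewrite -comp_iter Tp -[RHS]IHq addSn; apply/funext => x; rewrite iterSr.
Qed.

Lemma simple_generated_semigroupP (X : zmodType) (T : X -> X) :
  iter 2 T <> (fun=> 0) ->
  simple_semigroup (generated_semigroup T) <->
  exists2 p, (0 < p)%N & iter p.+1 T = T.
Proof.
move=> T2; split=> [simpleT|[[//|p] _ Tp] J [JS idealJ] [A JA _]].
  have JT := simpleT _ (semigroup_ideal_iter_gt T 1).
  have [[|[|p]]// _ Tp] : [set iter n T | n in [set n | (1 < n)%N]] T.
    by rewrite JT; [exists 1%N|exists (iter 2 T) => //; exists 2%N].
  by exists p.+1.
apply/seteqP; split=> // _ [[//|k] _ <-].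
have [n n1 An] := JS _ JA.
have -> : iter k.+1 T = A \o iter (k.+1 + n * p) T.
  by rewrite -An comp_iter addnCA -mulnS iter_periodic.
by apply: (idealJ _ _ JA _).2; exists (k.+1 + n * p)%N.
Qed.

Section InnerProduct.
Context {C : numClosedFieldType} {H : lmodType C}.
Variable dot : {dot H for (@Num.conj C)}.
Implicit Types (x y u v : H) (A B : {fset H}) (E : set H).

Lemma dotC u v : dot u v = (dot v u)^*.
Proof. by rewrite hermC mul1r. Qed.

Lemma dot_CauchySchwarz u v : `|dot u v| ^+ 2 <= dot u u * dot v v.
Proof.
have [->|v0] := eqVneq v 0; first by rewrite !linear0r normr0 expr0n.
have vv0 : 0 < dot v v by rewrite dnorm_gt0.
pose c := dot u v / dot v v.
have uv_ortho : dot (u - c *: v) (c *: v) = 0.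
  by rewrite linearZr_LR linearBl linearZl_LR /= divfK ?gt_eqF// subrr mulr0.
have uE : dot u u = dot (u - c *: v) (u - c *: v) + `|c| ^+ 2 * dot v v.
  by rewrite -dnormZ -(hnormDd uv_ortho) subrK.
have -> : `|dot u v| ^+ 2 = `|c| ^+ 2 * dot v v * dot v v.
  rewrite -mulrA -expr2 -exprMn -[X in _ * X]gtr0_norm// -normrM.
  by rewrite divfK ?gt_eqF.
by rewrite ler_pM2r// uE lerDr dnorm_ge0.
Qed.

Definition dot_normalize x : H := (sqrtC (dot x x))^-1 *: x.

Lemma dnorm_normalize x : x != 0 -> dot (dot_normalize x) (dot_normalize x) = 1.
Proof.
move=> x0; rewrite dnormZ normfV ger0_norm ?sqrt_dnorm_ge0//.
by rewrite exprVn sqrtCK mulVf ?dnorm_eq0.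
Qed.

Definition dyad (b a : H) : H -> H := fun x => dot x a *: b.

Lemma iter_dyad (b a : H) n x :
  iter n.+1 (dyad b a) x = dot b a ^+ n *: dyad b a x.
Proof.
elim: n => [|n IHn]; first by rewrite expr0 scale1r.
by rewrite iterS IHn /dyad !scalerA linearZl_LR /= mulrAC -exprSr.
Qed.

Lemma simple_semigroup_dyadP (b a : H) : dot b a != 0 ->
  simple_semigroup (generated_semigroup (dyad b a)) <->
  exists2 n, (0 < n)%N & dot b a ^+ n = 1.
Proof.
move=> ba0; have b0 : b != 0 by apply: contraNneq ba0 => ->; rewrite linear0l.
have dyadb0 : dyad b a b != 0 by rewrite scaler_eq0 negb_or ba0.
rewrite simple_generated_semigroupP; last first.
  move=> /(congr1 (@^~ b)) /eqP; rewrite iter_dyad expr1 scaler_eq0.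
  by rewrite (negbTE ba0) (negbTE dyadb0).
split=> -[n n0 ban]; exists n => //; last first.
  by apply/funext => x; rewrite iter_dyad ban scale1r.
have /eqP := congr1 (@^~ b) ban; rewrite iter_dyad -subr_eq0.
rewrite -[X in _ - X]scale1r -scalerBl scaler_eq0 (negbTE dyadb0) orbF subr_eq0.
by move/eqP.
Qed.

Definition orthonormal_set E : Prop :=
  forall e f, E e -> E f -> dot e f = (e == f)%:R.

Definition total_set E : Prop :=
  forall x, (forall e, E e -> dot x e = 0) -> x = 0.

Lemma orthonormal_setU1 E u : orthonormal_set E -> dot u u = 1 ->
  (forall e, E e -> dot u e = 0) -> orthonormal_set (E `|` [set u]).
Proof.
move=> onE uu uE.
have ue e : E e -> (u == e) = false.
  move=> Ee; apply/eqP => ue; move: (uE e Ee) => /eqP.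
  by rewrite -ue uu oner_eq0.
move=> e f [Ee|->] [Ef|->].
- exact: onE.
- by rewrite dotC uE// eq_sym ue// rmorph0.
- by rewrite uE// ue.
- by rewrite uu eqxx.
Qed.

Lemma total_orthonormal_set_exists : exists2 E, orthonormal_set E & total_set E.
Proof.
have [|E [onE maxE]] := @Zorn_bigcup H orthonormal_set.
  move=> F FP totF e f [X FX Xe] [Y FY Yf].
  have [XY|YX] := totF _ _ FX FY; first by apply: (FP _ FY) => //; exact: XY.
  by apply: (FP _ FX) => //; exact: YX.
exists E => // x xE; apply/eqP/negPn/negP => x0.
have uE e : E e -> dot (dot_normalize x) e = 0.
  by move=> Ee; rewrite linearZl_LR /= (xE _ Ee) mulr0.
apply: (maxE (E `|` [set dot_normalize x])); last first.
  by apply: orthonormal_setU1 => //; exact: dnorm_normalize.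
split=> [|/(_ _ (or_intror erefl)) /uE/eqP]; first exact: subsetUl.
by rewrite dnorm_normalize// oner_eq0.
Qed.

Variable E : set H.
Hypothesis onE : orthonormal_set E.

Definition fourier_sum x A : H := \sum_(e <- A | e \in E) dot x e *: e.

Definition fourier_sqr x A : C := \sum_(e <- A | e \in E) `|dot x e| ^+ 2.

Lemma dot_fourier_suml x y A :
  dot (fourier_sum x A) y = \sum_(e <- A | e \in E) dot x e * dot e y.
Proof.
by rewrite linear_sumlz; apply: eq_bigr => e _; rewrite linearZl_LR.
Qed.

Lemma dot_fourier_sum_mem x A f : E f -> f \in A ->
  dot (fourier_sum x A) f = dot x f.
Proof.
move=> Ef fA; rewrite dot_fourier_suml (big_rem f)//= mem_set//.
rewrite (onE Ef Ef) eqxx mulr1 big1_seq ?addr0// => e.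
rewrite mem_rem_uniq ?fset_uniq// inE => /andP[/set_mem Ee /andP[ef _]].
by rewrite (onE Ee Ef) (negbTE ef) mulr0.
Qed.

Lemma dot_fourier_sumr x A : dot x (fourier_sum x A) = fourier_sqr x A.
Proof.
rewrite dotC dot_fourier_suml rmorph_sum; apply: eq_bigr => e _.
by rewrite rmorphM /= -(dotC x e) mulrC -normCK.
Qed.

Lemma dnorm_fourier_sum x A :
  dot (fourier_sum x A) (fourier_sum x A) = fourier_sqr x A.
Proof.
rewrite dot_fourier_suml big_seq_cond [RHS]big_seq_cond.
apply: eq_bigr => e /andP[eA /set_mem Ee].
by rewrite [dot e _]dotC dot_fourier_sum_mem// normCK.
Qed.

Lemma bessel x A : fourier_sqr x A <= dot x x.
Proof.
have /hnormDd : dot (x - fourier_sum x A) (fourier_sum x A) = 0.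
  by rewrite linearBl /= dot_fourier_sumr dnorm_fourier_sum subrr.
by rewrite subrK /= dnorm_fourier_sum => ->; rewrite lerDr dnorm_ge0.
Qed.

Lemma dnorm_fourier_sumB x A B : (A `<=` B)%fset ->
  dot (fourier_sum x B - fourier_sum x A) (fourier_sum x B - fourier_sum x A) =
  fourier_sqr x B - fourier_sqr x A.
Proof.
by move=> AB; rewrite /fourier_sum /fourier_sqr -!sumr_fsetD// dnorm_fourier_sum.
Qed.

End InnerProduct.

Local Open Scope complex_scope.

Lemma complex_has_sup_adherent (R : realType) (S : set R[i]) (eps : R[i]) :
  has_sup S -> 0 < eps -> exists2 x, S x & forall y, S y -> y - x < eps.
Proof.
move=> [[x0 Sx0] [M SM]]; rewrite ltcE => /andP[/eqP/= Imeps Reeps].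
have ImS x : S x -> complex.Im x = complex.Im M.
  by move=> /SM; rewrite lecE => /andP[/eqP].
have supS : has_sup (@complex.Re R @` S).
  split; first by exists (complex.Re x0), x0.
  by exists (complex.Re M) => _ [x /SM + <-]; rewrite lecE => /andP[].
have [_ [x Sx <-] xsup] := sup_adherent Reeps supS.
exists x => // y Sy; rewrite ltcE !raddfB /= Imeps !ImS// subrr eqxx /=.
rewrite ltrBlDl; rewrite ltrBlDr in xsup; apply: le_lt_trans xsup.
by apply: sup_upper_bound => //; exists y.
Qed.

#[local] Existing Instance totally_filter.

Section HilbertSpace.
Context {R : realType} {H : completeNormedModType R[i]}.
Variable dot : {dot H for (@Num.conj R[i])}.

Lemma has_trace_unique (T : H -> H) (a b : R[i]) :
  has_trace dot T a -> has_trace dot T b -> a = b.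
Proof.
have [E onE totalE] := total_orthonormal_set_exists dot.
move=> /(_ E (conj onE totalE)) Ta /(_ E (conj onE totalE)) Tb.
exact: (cvg_unique (@norm_hausdorff _ R[i]^o) Ta Tb).
Qed.

Lemma has_trace_eq (T : H -> H) (c : R[i]) :
  has_trace dot T c -> trace dot T = c.
Proof.
move=> Tc; apply: has_trace_unique (Tc).
by apply: (@xgetPex _ 0 [set c | has_trace dot T c]); exists c.
Qed.

Lemma selfadjoint_rank_one_dyad (T : H -> H) :
  selfadjoint dot T -> rank_one T ->
  exists b a, T = dyad dot b a /\ dot b a \is Num.real.
Proof.
move=> saT [v v0 rangeT]; have vv0 : dot v v != 0 by rewrite dnorm_eq0.
have Tv x : exists c, T x = c *: v.
  have : range T (T x) by exists x.
  by rewrite rangeT => -[c _ <-]; exists c.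
have vvR : (dot v v)^-1 \is Num.real by rewrite rpredV ger0_real ?dnorm_ge0.
have dotZVr x y : dot x ((dot v v)^-1 *: y) = (dot v v)^-1 * dot x y.
  by rewrite linearZr_LR /= conj_Creal.
exists v, ((dot v v)^-1 *: T v); split; last first.
  by rewrite dotZVr rpredM//; apply/CrealP; rewrite -dotC saT.
apply/funext => x; have [c Tx] := Tv x.
by rewrite /dyad dotZVr -saT Tx linearZl_LR /= mulrC mulfK.
Qed.

Hypothesis dot_norm : norm_from_dot dot.

Lemma norm_dot_le (x y : H) : `|dot x y| <= `|x| * `|y|.
Proof.
rewrite -(@ler_pXn2r _ 2)// ?nnegrE ?mulr_ge0// exprMn !dot_norm.
exact: dot_CauchySchwarz.
Qed.

Lemma dot_continuousl (y : H) : continuous ((dot ^~ y) : H -> R[i]^o).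
Proof.
move=> x; apply/(@cvgrPdist_le _ R[i]^o) => eps eps0; near=> z.
rewrite -linearBl /= (le_trans (norm_dot_le _ _))//.
have y1 : 0 < `|y| + 1 by rewrite ltr_wpDl.
apply: (@le_trans _ _ (`|x - z| * (`|y| + 1))).
  by rewrite ler_wpM2l// lerDl.
rewrite -ler_pdivlMr//; near: z.
by apply: cvgr_dist_le; [exact: cvg_id|rewrite divr_gt0].
Unshelve. all: by end_near. Qed.

Lemma cvg_dotl (I : Type) (F : set_system I) {FF : Filter F} (f : I -> H)
    (x y : H) :
  f @ F --> x -> dot (f i) y @[i --> F] --> (dot x y : R[i]^o).
Proof. by move=> fx; exact: cvg_comp fx (@dot_continuousl y x). Qed.

Lemma is_cvg_fourier_sum (E : set H) (x : H) : orthonormal_set dot E ->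
  cvg (fourier_sum dot E x A @[A --> totally]).
Proof.
move=> onE; apply: cauchy_cvg; apply: cauchy_exP => eps eps0.
have sup_sqr : has_sup (range (fourier_sqr dot E x)).
  split; first by exists (fourier_sqr dot E x fset0), fset0.
  by exists (dot x x) => _ [A _ <-]; exact: bessel.
have [_ [A _ <-] Asup] := complex_has_sup_adherent sup_sqr (exprn_gt0 2 eps0).
exists (fourier_sum dot E x A), A => //= B /= AB.
rewrite -ball_normE /= distrC -(@ltr_pXn2r _ 2)// ?nnegrE// ?ltW//.
by rewrite dot_norm dnorm_fourier_sumB//; apply: Asup; exists B.
Qed.

Lemma cvg_fourier_sum (E : set H) (x : H) : orthonormal_basis dot E ->
  fourier_sum dot E x A @[A --> totally] --> x.
Proof.
move=> [onE totalE]; have /cvg_ex[/= w cvgw] := @is_cvg_fourier_sum E x onE.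
suff wx : w = x by rewrite wx in cvgw.
apply/eqP; rewrite -subr_eq0; apply/eqP; apply: totalE => e Ee.
apply/eqP; rewrite linearBl /= subr_eq0; apply/eqP.
have dot_cvgx : dot (fourier_sum dot E x A) e @[A --> totally] -->
    (dot x e : R[i]^o).
  apply: cvg_near_cst; exists [fset e]%fset => // A /=.
  by rewrite fsub1set => eA; rewrite dot_fourier_sum_mem.
exact: (cvg_unique (@norm_hausdorff _ R[i]^o) (cvg_dotl cvgw) dot_cvgx).
Qed.

Lemma parseval (E : set H) (x y : H) : orthonormal_basis dot E ->
  \sum_(e <- (A : {fset H}) | e \in E) dot x e * dot e y @[A --> totally] -->
  (dot x y : R[i]^o).
Proof.
move=> basisE; under eq_fun do rewrite -dot_fourier_suml.
by apply: cvg_dotl; exact: cvg_fourier_sum.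
Qed.

Lemma has_trace_dyad (b a : H) : has_trace dot (dyad dot b a) (dot b a).
Proof.
move=> E basisE; under eq_fun do rewrite partial_sum_patch.
under eq_fun => A do under eq_bigr => e _ do rewrite linearZl_LR /= mulrC.
exact: parseval.
Qed.

End HilbertSpace.

Theorem theorem3p10 (R : realType) (H : completeNormedModType R[i])
    (dot : {dot H for (@Num.conj R[i])}) (dot_norm : norm_from_dot dot)
    (T : {linear H -> H}) (T_bounded : bounded_operator T)
    (T_selfadjoint : selfadjoint dot T) (T_rank1 : rank_one T)
    (trT_neq0 : trace dot T <> 0) :
  simple_semigroup (generated_semigroup T) <->
  trace dot T = -1 \/ trace dot T = 1.
Proof.
have [b [a [TE baR]]] := selfadjoint_rank_one_dyad T_selfadjoint T_rank1.
have trT : trace dot T = dot b a.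
  by rewrite TE; apply: has_trace_eq; exact: has_trace_dyad.
rewrite trT in trT_neq0 *; rewrite TE simple_semigroup_dyadP; last exact/eqP.
exact: real_unity_rootP.
Qed.
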